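(* Let $p\geqslant 1$ and let $V,F\in\mathcal C^\infty(\mathbb R^p)$ have bounded Hessians, with $F$ even. Assume that $\nabla^2F\geqslant-\kappa I_p$ for some $\kappa\geqslant 0$ and that $\nabla^2V\geqslant(\lambda+4\kappa)I_p$ for some $\lambda>0$. Set $\Lambda=\|\nabla^2V\|_\infty+4\|\nabla^2F\|_\infty$. Then for all $N\in\mathbb N$, $N\geqslant 1$, the potential $U\in\mathcal C^\infty(\mathbb R^{pN})$ given by $$U(x)=\sum_{i=1}^NV(x_i)+\sum_{i=1}^{N-1}F(x_i-x_{i+1}),\qquad x=(x_1,\dots,x_N)\in(\mathbb R^p)^N,$$ satisfies $\lambda I_{pN}\leqslant\nabla^2U(x)\leqslant\Lambda I_{pN}$ for all $x\in\mathbb R^{pN}$. As a consequence, if $\gamma\geqslant2\sqrt\Lambda$, then for all $N\in\mathbb N$, $N\geqslant1$, the drift of the chain of oscillators $$\forall i\in\{1,\dots,N\},\qquad\mathrm dX_{i,t}=Y_{i,t}\,\mathrm dt,\qquad\mathrm dY_{i,t}=-\nabla_{x_i}U(X_t)\,\mathrm dt-\gamma Y_{i,t}\,\mathrm dt+\sqrt{2\gamma T_i}\,\mathrm dW_{i,t}$$ satisfies $\mathrm{Cont}_R(M,\rho)$ with $\rho=\lambda/(3\gamma)$ and a symmetric positive definite $2pN\times 2pN$ matrix $M$ which satisfies $\frac12\min(1,\Lambda^{-1})I_{2pN}\leqslant M\leqslant\frac32\max(1,\Lambda^{-1})I_{2pN}$.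
   Context: $T_1,\dots,T_N\geqslant0$ are arbitrary temperatures and $W=(W_1,\dots,W_N)$ is a standard Brownian motion on $\mathbb R^{pN}$; $X=(X_1,\dots,X_N)$ and $Y=(Y_1,\dots,Y_N)$ are $\mathbb R^{pN}$-valued. The drift of the process is $b(x,y)=(y,\,-\nabla U(x)-\gamma y)$ on $\mathbb R^{pN}\times\mathbb R^{pN}$. $\|\nabla^2V\|_\infty$ denotes the supremum over $\mathbb R^p$ of the operator norm of the Hessian of $V$ (same for $F$). For real square matrices, not necessarily symmetric, $A\leqslant B$ means $u\cdot Au\leqslant u\cdot Bu$ for all vectors $u$. For a smooth map $b:\mathbb R^d\to\mathbb R^d$ with Jacobian matrix $J_b(z)=(\partial_{z_j}b_i(z))_{1\leqslant i,j\leqslant d}$, a real symmetric positive definite $d\times d$ matrix $M$ and $\rho\in\mathbb R$, the condition $\mathrm{Cont}_R(M,\rho)$ means: $MJ_b(z)\leqslant-\rho M$ for all $z\in\mathbb R^d$. *)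

(* Defs.v *)
From HB Require Import structures.
From mathcomp Require Import all_boot all_order all_algebra.
From mathcomp Require Import all_classical all_reals all_analysis.
Set Implicit Arguments.
Unset Strict Implicit.
Unset Printing Implicit Defensive.
Import Order.TTheory GRing.Theory Num.Theory.
Import numFieldNormedType.Exports.
Local Open Scope classical_set_scope.
Local Open Scope ring_scope.

(* Points of R^n, at which functions are evaluated, are row vectors; the
   vectors on which matrices act are column vectors. *)

Section Calculus.
Variables (R : realType) (n : nat).
Implicit Types f : 'rV[R]_n -> R.

Definition partial (i : 'I_n) f : 'rV[R]_n -> R :=
  fun x => 'D_(delta_mx 0 i) f x.

Definition iter_partial (s : seq 'I_n) f : 'rV[R]_n -> R := foldr partial f s.

(* C^oo: partial derivatives of all orders exist everywhere and are
   continuous. The existence clause is not redundant, as 'D_v is total. *)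
Definition smooth f : Prop :=
  forall s : seq 'I_n,
    continuous (iter_partial s f) /\
    forall i x, derivable (iter_partial s f) x (delta_mx 0 i).

Definition grad f (x : 'rV[R]_n) : 'rV[R]_n := \row_j partial j f x.

Definition hess f (x : 'rV[R]_n) : 'M[R]_n :=
  \matrix_(i, j) partial i (partial j f) x.

Definition Jac (b : 'rV[R]_n -> 'rV[R]_n) (z : 'rV[R]_n) : 'M[R]_n :=
  \matrix_(i, j) partial j (fun w => b w 0 i) z.

End Calculus.

Section Matrices.
Variables (R : realType) (n : nat).
Implicit Types (A B M : 'M[R]_n) (u : 'cV[R]_n).

(* The form u . A u; A is not assumed to be symmetric. *)
Definition qform A u : R := (u^T *m (A *m u)) 0 0.

Definition mxle A B : Prop := forall u, qform A u <= qform B u.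

Definition posdefmx M : Prop := forall u, u != 0 -> 0 < qform M u.

(* The norm `|_| of the library on matrices is the sup norm, hence this one. *)
Definition enorm u : R := Num.sqrt (\sum_i u i 0 ^+ 2).

Definition opnorm A : R := sup [set enorm (A *m u) | u in [set u | enorm u <= 1]].

End Matrices.

Section HessianNorm.
Variables (R : realType) (n : nat) (f : 'rV[R]_n -> R).

Definition bounded_hess : Prop := has_ubound (range (fun x => opnorm (hess f x))).

Definition hess_norm : R := sup (range (fun x => opnorm (hess f x))).

End HessianNorm.

(* Used for smooth b and symmetric positive definite M; these are not part of
   the condition itself. *)
Definition Cont_R (R : realType) (d : nat) (b : 'rV[R]_d -> 'rV[R]_d)
    (M : 'M[R]_d) (rho : R) : Prop :=
  forall z, mxle (M *m Jac b z) (- rho *: M).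

(* dZ_t = drift (Z_t) dt + diffusion (Z_t) dW_t, with W a standard Brownian
   motion on R^m. *)
Record sde (R : realType) (d m : nat) := Sde {
  drift : 'rV[R]_d -> 'rV[R]_d;
  diffusion : 'rV[R]_d -> 'M[R]_(d, m)
}.

Section Chain.
Variables (R : realType) (p N : nat).

(* (R^p)^N is 'rV_(N * p), the i-th block being the i-th row of the N x p
   matrix obtained by vec_mx. *)
Definition block (x : 'rV[R]_(N * p)) (i : 'I_N) : 'rV[R]_p :=
  row i (vec_mx x).

(* The constraint on j leaves exactly the consecutive pairs (i, i + 1). *)
Definition chain_potential (V F : 'rV[R]_p -> R) (x : 'rV[R]_(N * p)) : R :=
  \sum_(i < N) V (block x i) +
  \sum_(i < N) \sum_(j < N | j == i.+1 :> nat) F (block x i - block x j).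

(* The state is z = (x, y), positions first; the i-th block of the noise only
   acts on the i-th velocity, with intensity sqrt (2 gamma T_i). *)
Definition chain_sde (V F : 'rV[R]_p -> R) (gamma : R) (T : 'I_N -> R) :
    sde R (N * p + N * p) (N * p) :=
  {| drift := fun z =>
       row_mx (rsubmx z)
         (- grad (chain_potential V F) (lsubmx z) - gamma *: rsubmx z);
     diffusion := fun=>
       col_mx 0
         (diag_mx (mxvec (\matrix_(i < N, k < p) Num.sqrt (2 * gamma * T i)))) |}.

End Chain.

(* Main.v *)
Require Import Defs.
From mathcomp Require Import all_boot all_order all_algebra.
From mathcomp Require Import all_classical all_reals all_analysis.
From mathcomp Require Import ring lra.
Import Order.TTheory GRing.Theory Num.Theory.
Import numFieldNormedType.Exports.
Set Implicit Arguments.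
Unset Strict Implicit.
Unset Printing Implicit Defensive.
Local Open Scope classical_set_scope.
Local Open Scope ring_scope.

(* The form of hess U at u is the sum of the forms of hess V at the blocks u_i
   and of those of hess F at the differences u_i - u_(i+1). Since
   |u_i - u_(i+1)|^2 <= 2 |u_i|^2 + 2 |u_(i+1)|^2 and every index lies on at most
   two edges, the differences contribute at most 4 |u|^2, whence the bounds.

   For the contraction, M has blocks 1, 1/gamma, 1/gamma, 1/Lambda. As
   gamma^2 >= 4 Lambda, its off-diagonal part is at most half of its diagonal
   part. With A = hess U, which is symmetric by Schwarz's theorem, the form of
   M J at (a, b) is
     - a.Aa / gamma - b.Aa / Lambda + (1/gamma - gamma/Lambda) |b|^2,
   and the cross term is absorbed using that the form of A is nonnegative at
   a + (gamma/Lambda) b. *)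

(** * Directional derivatives under scaling of the direction and under linear maps *)

(** For [c != 0], the quotient along [c *: v] at [h] is [c] times the quotient along [v] at [h * c],
    and [h * c] tends to 0 without reaching it. *)
Lemma is_derive_scale_dir (R : realType) (V W : normedModType R) (f : V -> W)
    (x v : V) (df : W) (c : R) :
  is_derive x v f df -> is_derive x (c *: v) f (c *: df).
Proof.
have [->|c0] := eqVneq c 0; first by rewrite !scale0r => _; exact: is_derive0.
move=> [fv <-]; set g := fun h => h^-1 *: ((f \o shift x) (h *: v) - f x).
have cvgc : (fun h : R => h * c) @ 0^' --> 0^'.
  move=> A [e/= e0 eA]; exists (e / `|c|); first by rewrite /= divr_gt0 ?normr_gt0.
  move=> h /=; rewrite sub0r normrN ltr_pdivlMr ?normr_gt0// => he h0.
  by apply: eA; rewrite /= ?mulf_neq0// sub0r normrN normrM.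
have gc : c *: (g (h * c)) @[h --> 0^'] --> c *: 'D_v f x.
  by apply: cvgZl_tmp; apply: (cvg_comp _ _ cvgc); exact: fv.
have E : (fun h => c *: g (h * c)) =
    (fun h => h^-1 *: ((f \o shift x) (h *: (c *: v)) - f x)).
  apply/funext => h; by rewrite /g /= !scalerA invfM mulrCA mulfV// mulr1.
rewrite E in gc; split; first by apply/cvg_ex; exists (c *: 'D_v f x).
exact: cvg_lim gc.
Qed.

(** By linearity the two difference quotients are the same function of [h], so a derivative of [f]
    in the single direction [L v] suffices. *)
Lemma is_derive_comp_linear (R : realType) (V W U : normedModType R)
    (L : {linear V -> W}) (f : W -> U) (x v : V) (df : U) :
  is_derive (L x) (L v) f df -> is_derive x v (f \o L) df.
Proof.
have E : (fun h : R => h^-1 *: ((f \o shift (L x)) (h *: L v) - f (L x))) =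
    (fun h => h^-1 *: (((f \o L) \o shift x) (h *: v) - (f \o L) x)).
  by apply/funext => h; rewrite /= (linearD L) (linearZ_LR L).
by move=> [dL <-]; split; rewrite /derivable /derive -E.
Qed.

Lemma is_derive_iter_partial (R : realType) n (f : 'rV[R]_n -> R) s i x :
  smooth f ->
  is_derive x (delta_mx 0 i) (iter_partial s f) (iter_partial (i :: s) f x).
Proof. by move=> /(_ s)[_ df]; apply: DeriveDef => //; exact: df. Qed.

(** In finite dimension [L] is a finite sum of coordinates times fixed vectors. *)
Lemma continuous_linear_rV (R : realType) m n (L : {linear 'rV[R]_m -> 'rV[R]_n}) :
  continuous L.
Proof.
have -> : L = (fun x => \sum_i x 0 i *: L (delta_mx 0 i)) :> (_ -> _).
  apply/funext => x; rewrite {1}[x]row_sum_delta linear_sum.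
  by apply: eq_bigr => i _; rewrite linearZ_LR.
apply: continuous_big => [|i _ x]; first exact: add_continuous.
by apply: cvgZr_tmp; [exact: nbhs_filter|exact: coord_continuous].
Qed.

(** * Composition with linear maps sending coordinate vectors to multiples of coordinate vectors *)

Section MonomialLinear.
Variables (R : realType) (m n : nat).

(* For such L the partial derivatives of f \o L are, up to a factor, partial
   derivatives of f: no chain rule, hence no total differentiability, is needed. *)
Definition monomial_linear (L : 'rV[R]_m -> 'rV[R]_n) :=
  forall i, exists k e, L (delta_mx 0 i) = e *: delta_mx 0 k.

Variable (L : {linear 'rV[R]_m -> 'rV[R]_n}).
Hypothesis mL : monomial_linear L.
Implicit Type f : 'rV[R]_n -> R.

Lemma is_derive_iter_partial_comp f s i k e x : smooth f ->
    L (delta_mx 0 i) = e *: delta_mx 0 k ->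
  is_derive x (delta_mx 0 i) (iter_partial s f \o L)
    (e * iter_partial (k :: s) f (L x)).
Proof.
move=> sf Li; apply: is_derive_comp_linear; rewrite Li.
by apply: is_derive_scale_dir; exact: is_derive_iter_partial.
Qed.

(** Each differentiation contributes a factor [e] to [c] and an index [k] to [s']. Their values can
    stay hidden, since only continuity and derivability are deduced from this form. *)
Lemma iter_partial_comp f s : smooth f ->
  exists c s', iter_partial s (f \o L) = c *: (iter_partial s' f \o L).
Proof.
move=> sf; elim: s => [|i s [c [s' IH]]].
  by exists 1, [::]; rewrite scale1r.
have [k [e Li]] := mL i; exists (c * e), (k :: s'); apply/funext => x.
have d := is_derive_iter_partial_comp s' x sf Li.
by rewrite /= IH /partial derive_val; exact: mulrA.
Qed.

Lemma smooth_comp f : smooth f -> smooth (f \o L).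
Proof.
move=> sf s; have [c [s' ->]] := iter_partial_comp s sf; split.
  move=> x; apply: cvgZl_tmp; first exact: nbhs_filter.
  apply: continuous_comp; first exact: continuous_linear_rV.
  by have [cf _] := sf s'; exact: cf.
move=> i x; have [k [e Li]] := mL i; apply: derivableZ.
by have [] := is_derive_iter_partial_comp s' x sf Li.
Qed.

(** Each row of [lin1_mx L] has at most one nonzero entry, so both matrix products collapse to the
    single term indexed by [k] and [l]. *)
Lemma hess_comp f x : smooth f ->
  hess (f \o L) x = lin1_mx L *m hess f (L x) *m (lin1_mx L)^T.
Proof.
move=> sf; apply/matrixP => i j.
have [[k [e Li]] [l [d Lj]]] := (mL i, mL j).
have -> : hess (f \o L) x i j = e * (d * hess f (L x) k l).
  rewrite !mxE; have -> : partial j (f \o L) = d *: (partial l f \o L).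
    apply/funext => y.
    by have h := is_derive_iter_partial_comp [::] y sf Lj; rewrite /partial derive_val.
  have h := is_derive_iter_partial_comp [:: l] x sf Li.
  by rewrite {1}/partial derive_val mulrCA.
have entryL a b c t : L (delta_mx 0 a) = t *: delta_mx 0 c ->
    lin1_mx L a b = t * (b == c)%:R by move=> La; rewrite mxE La !mxE.
rewrite [RHS]mxE (bigD1 l)//= big1 => [|b bl]; last first.
  by rewrite [X in _ * X]mxE (entryL _ _ _ _ Lj) (negbTE bl) !mulr0.
have -> : (lin1_mx L *m hess f (L x)) i l = e * hess f (L x) k l.
  rewrite mxE (bigD1 k)//= big1 => [|b bk]; last first.
    by rewrite (entryL _ _ _ _ Li) (negbTE bk) mulr0 mul0r.
  by rewrite addr0 (entryL _ _ _ _ Li) eqxx mulr1.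
by rewrite [_^T _ _]mxE (entryL _ _ _ _ Lj) eqxx mulr1 addr0 [d * _]mulrC mulrA.
Qed.

End MonomialLinear.

(** * Schwarz's theorem, by restriction to lines and the mean value theorem *)

Lemma is_derive_line (R : realType) (V W : normedModType R) (f : V -> W)
    (x v : V) (t : R) (df : W) :
  is_derive (t *: v + x) v f df -> is_derive t (1 : R) (fun s => f (s *: v + x)) df.
Proof.
have E : (fun h : R => h^-1 *: ((f \o shift (t *: v + x)) (h *: v) - f (t *: v + x))) =
    (fun h => h^-1 *: (((fun s => f (s *: v + x)) \o shift t) (h *: (1 : R)) -
                       f (t *: v + x))).
  by apply/funext => h; rewrite /= [h *: 1]mulr1 scalerDl addrA.
by move=> [dL <-]; split; rewrite /derivable /derive -E.
Qed.

Lemma mean_value (R : realType) (g dg : R -> R) (h : R) : 0 < h ->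
    (forall t, is_derive t (1 : R) g (dg t)) ->
  exists2 a, 0 < a < h & g h - g 0 = dg a * h.
Proof.
move=> h0 dg_g; have dgx x : derivable g x 1 by have [] := dg_g x.
have [|a] := @MVT R g dg 0 h h0 (fun t _ => dg_g t).
  by apply: derivable_within_continuous => t _; exact: dgx.
by rewrite in_itv subr0; exists a.
Qed.

(** The mean value theorem is applied twice: along [i] to the difference of [f] on two parallel
    lines, then along [j] to [partial i f]. *)
Lemma second_difference_mean_value (R : realType) n (f : 'rV[R]_n -> R)
    (i j : 'I_n) (x : 'rV[R]_n) (h : R) : smooth f -> 0 < h ->
  exists a b, [/\ 0 < a < h, 0 < b < h &
    f (h *: delta_mx 0 i + (h *: delta_mx 0 j + x)) - f (h *: delta_mx 0 i + x)
      - (f (h *: delta_mx 0 j + x) - f x) =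
    partial j (partial i f) (b *: delta_mx 0 j + (a *: delta_mx 0 i + x)) * h * h].
Proof.
move=> sf h0; set di := delta_mx 0 i; set dj := delta_mx 0 j.
have line s k (y : 'rV[R]_n) t : is_derive t (1 : R)
    (fun u => iter_partial s f (u *: delta_mx 0 k + y))
    (iter_partial (k :: s) f (t *: delta_mx 0 k + y)).
  exact/is_derive_line/is_derive_iter_partial.
have [a ah E1] := mean_value h0
  (fun t => is_deriveB (line [::] i (h *: dj + x) t) (line [::] i x t)).
have [b bh E2] := mean_value h0 (line [:: i] j (a *: di + x)).
exists a, b; split=> //; move: E1 E2; rewrite /= !fctE !scale0r !add0r => -> E2.
by rewrite -E2 addrCA.
Qed.

(* Schwarz: the symmetric second difference, divided by h^2, is a value near x
   of either mixed derivative. *)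
Lemma partialC (R : realType) n (f : 'rV[R]_n -> R) (i j : 'I_n) x : smooth f ->
  partial i (partial j f) x = partial j (partial i f) x.
Proof.
move=> sf; have tri (p q t u e : R) :
    t = u -> `|p - t| < e / 2 -> `|q - u| < e / 2 -> `|q - p| <= e.
  move=> -> pu qu; rewrite (le_trans (ler_distD u _ _))// [e]splitr.
  by rewrite lerD ?ltW// distrC.
apply/eqP; rewrite -subr_eq0 -normr_le0; apply/ler_addgt0Pl => e e0.
rewrite addr0.
have close k l : exists2 r : R, 0 < r & forall y, `|y| < r ->
    `|partial k (partial l f) x - partial k (partial l f) (y + x)| < e / 2.
  have [+ _] := sf [:: k; l] => /(_ x).
  move=> /cvgrPdist_lt /(_ _ (divr_gt0 e0 (ltr0Sn R 1))).
  move=> /nbhs_ballP[r/= r0 br]; exists r => // y yr; apply: br.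
  by rewrite -ball_normE /= opprD addrC subrK normrN.
have [[r r0 Hr] [s s0 Hs]] := (close i j, close j i).
pose di : 'rV[R]_n := delta_mx 0 i; pose dj : 'rV[R]_n := delta_mx 0 j.
(* The summand 1 makes [K] positive and the bound in [small] strict; the minimum serves both mixed
   derivatives with one [h]. *)
pose K := `|di| + `|dj| + 1; pose h := Num.min r s / K.
have K0 : 0 < K by rewrite ltr_wpDl.
have m0 : 0 < Num.min r s by rewrite lt_min r0.
have h0 : 0 < h by rewrite divr_gt0.
have small a b : 0 < a < h -> 0 < b < h -> `|a *: di + b *: dj| < Num.min r s.
  move=> /andP[a0 ah] /andP[b0 bh]; apply: (@le_lt_trans _ _ (h * (`|di| + `|dj|))).
    rewrite (le_trans (ler_normD _ _))// !normrZ !gtr0_norm// mulrDr.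
    by rewrite lerD// ler_wpM2r// ltW.
  have -> : Num.min r s = h * K by rewrite mulfVK ?gt_eqF.
  by rewrite ltr_pM2l// ltrDl.
have [a [b [ah bh Eab]]] := second_difference_mean_value i j x sf h0.
have [c [d [ch dh Ecd]]] := second_difference_mean_value j i x sf h0.
(* The second difference is symmetric in [i] and [j], so both values times [h * h] agree, and [h]
   cancels twice. *)
have E : partial j (partial i f) (b *: dj + (a *: di + x)) =
         partial i (partial j f) (d *: di + (c *: dj + x)).
  apply: (mulIf (lt0r_neq0 h0)); apply: (mulIf (lt0r_neq0 h0)).
  apply: etrans (etrans (esym Eab) _) Ecd.
  rewrite (addrCA (h *: dj)) !opprB [LHS]addrACA [RHS]addrACA.
  by congr (_ + _); exact: addrC.
have H1 : `|partial j (partial i f) x -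
            partial j (partial i f) (b *: dj + (a *: di + x))| < e / 2.
  rewrite addrA [_ *: dj + _]addrC; apply: Hs.
  by have := small a b ah bh; rewrite lt_min => /andP[].
have H2 : `|partial i (partial j f) x -
            partial i (partial j f) (d *: di + (c *: dj + x))| < e / 2.
  rewrite addrA; apply: Hr.
  by have := small d c dh ch; rewrite lt_min => /andP[].
exact: tri E H1 H2.
Qed.

Lemma tr_hess (R : realType) n (f : 'rV[R]_n -> R) x : smooth f ->
  (hess f x)^T = hess f x.
Proof. by move=> sf; apply/matrixP => i j; rewrite !mxE partialC. Qed.

(** * Smoothness and Hessians of finite sums *)

Section SmoothSum.
Variables (R : realType) (n : nat).
Implicit Types f g : 'rV[R]_n -> R.

Lemma iter_partialD f g s : smooth f -> smooth g ->
  iter_partial s (f + g) = iter_partial s f + iter_partial s g.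
Proof.
move=> sf sg; elim: s => //= i s ->; apply/funext => x.
by rewrite /partial deriveD//; [case: (sf s) | case: (sg s)].
Qed.

Lemma smoothD f g : smooth f -> smooth g -> smooth (f + g).
Proof.
move=> sf sg s; rewrite iter_partialD//.
have [[cf df] [cg dg]] := (sf s, sg s).
split=> [x|i x]; first exact: (cvgD (cf x) (cg x)).
by apply: derivableD; [exact: df | exact: dg].
Qed.

Lemma smooth0 : smooth (0 : 'rV[R]_n -> R).
Proof.
move=> s; have -> : iter_partial s (0 : 'rV[R]_n -> R) = cst 0.
  by elim: s => //= i s ->; apply/funext => x; rewrite /partial derive_cst.
split; first exact: cst_continuous.
by move=> i x; exact: derivable_cst.
Qed.

Lemma hessD f g x : smooth f -> smooth g -> hess (f + g) x = hess f x + hess g x.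
Proof.
move=> sf sg; apply/matrixP => i j; rewrite !mxE.
by rewrite -[LHS]/(iter_partial [:: i; j] (f + g) x) iter_partialD.
Qed.

Lemma hess0 x : hess (0 : 'rV[R]_n -> R) x = 0.
Proof.
have d0 i : partial i (0 : 'rV[R]_n -> R) = 0.
  by apply/funext => y; rewrite /partial -[0]/(cst 0) derive_cst.
by apply/matrixP => i j; rewrite !mxE !d0.
Qed.

(** The two claims go through one induction because additivity of the Hessian requires the partial
    sums to be smooth. *)
Lemma smooth_hess_sum (I : Type) (r : seq I) (P : pred I)
    (f : I -> 'rV[R]_n -> R) x : (forall i, P i -> smooth (f i)) ->
  smooth (\sum_(i <- r | P i) f i) /\
  hess (\sum_(i <- r | P i) f i) x = \sum_(i <- r | P i) hess (f i) x.
Proof.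
move=> sf; elim/big_ind2 : _ => [|f1 H1 f2 H2 [sf1 <-] [sf2 <-]|i /sf].
- by split; [exact: smooth0 | exact: hess0].
- by split; [exact: smoothD | exact: hessD].
- by [].
Qed.

End SmoothSum.

Lemma qform_sum (R : realType) n (I : Type) (r : seq I) (P : pred I)
    (A : I -> 'M[R]_n) u :
  qform (\sum_(i <- r | P i) A i) u = \sum_(i <- r | P i) qform (A i) u.
Proof. by rewrite /qform mulmx_suml mulmx_sumr summxE. Qed.

Lemma qformD (R : realType) n (A B : 'M[R]_n) u :
  qform (A + B) u = qform A u + qform B u.
Proof. by rewrite /qform mulmxDl mulmxDr mxE. Qed.

(** Matrices of linear maps act on rows from the right, so [(lin1_mx L)^T *m u] is the transpose of
    [L u^T]. *)
Lemma qform_hess_comp (R : realType) m n (L : {linear 'rV[R]_m -> 'rV[R]_n})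
    (f : 'rV[R]_n -> R) x u : monomial_linear L -> smooth f ->
  qform (hess (f \o L) x) u = qform (hess f (L x)) (L u^T)^T.
Proof.
move=> mL sf; rewrite hess_comp// /qform trmxK -[in RHS]mul_rV_lin1.
by rewrite trmx_mul trmxK !mulmxA.
Qed.

(** * The Hessian form of the chain potential *)

Section ChainPotential.
Variables (R : realType) (p N : nat).
Implicit Types V F : 'rV[R]_p -> R.

(** This is [block] with its linear structure, as the composition lemmas require. *)
Definition block_lin (i : 'I_N) : {linear 'rV[R]_(N * p) -> 'rV[R]_p} :=
  row i \o @vec_mx R N p.

Definition edge_lin (i j : 'I_N) : {linear 'rV[R]_(N * p) -> 'rV[R]_p} :=
  block_lin i \- block_lin j.

Lemma block_delta i a (k : 'I_p) :
  block_lin i (delta_mx 0 (mxvec_index a k)) = (i == a)%:R *: delta_mx 0 k.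
Proof.
rewrite /= vec_mx_delta; apply/rowP => l; rewrite !mxE.
by case: (i == a); rewrite ?mul1r ?mul0r.
Qed.

Lemma monomial_block i : monomial_linear (block_lin i).
Proof.
by case/mxvec_indexP => a k; exists k, (i == a)%:R; exact: block_delta.
Qed.

(** Monomial maps are not closed under differences in general; here both blocks send a coordinate
    vector to multiples of the same [delta_mx 0 k]. *)
Lemma monomial_edge i j : monomial_linear (edge_lin i j).
Proof.
case/mxvec_indexP => a k; exists k, ((i == a)%:R - (j == a)%:R).
by rewrite -[LHS]/(block_lin i _ - block_lin j _) !block_delta -scalerBl.
Qed.

Lemma chain_potentialE V F : @chain_potential R p N V F =
  \sum_i (V \o block_lin i) +
  \sum_(i < N) \sum_(j < N | j == i.+1 :> nat) (F \o edge_lin i j).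
Proof.
apply/funext => x; rewrite /chain_potential !fctE !fct_sumE; congr (_ + _).
by apply: eq_bigr => i _; rewrite fct_sumE.
Qed.

Lemma smooth_qform_chain V F x u : smooth V -> smooth F ->
  smooth (@chain_potential R p N V F) /\
  qform (hess (chain_potential V F) x) u =
    \sum_i qform (hess V (block x i)) (block u^T i)^T +
    \sum_(i < N) \sum_(j < N | j == i.+1 :> nat)
      qform (hess F (block x i - block x j)) (block u^T i - block u^T j)^T.
Proof.
move=> sV sF; rewrite chain_potentialE.
have sVb i : smooth (V \o block_lin i).
  by apply: smooth_comp => //; exact: monomial_block.
have sFe i j : smooth (F \o edge_lin i j).
  by apply: smooth_comp => //; exact: monomial_edge.
have [s1 h1] := @smooth_hess_sum R _ _ (index_enum _) xpredT _ x (fun i _ => sVb i).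
have sh2 (i : 'I_N) := @smooth_hess_sum R _ _ (index_enum _)
  (fun j : 'I_N => j == i.+1 :> nat) _ x (fun j _ => sFe i j).
have [s2 h2] := @smooth_hess_sum R _ _ (index_enum _) xpredT _ x (fun i _ => (sh2 i).1).
split; first exact: smoothD.
rewrite hessD// h1 h2 qformD !qform_sum; congr (_ + _); apply: eq_bigr => i _.
  by rewrite qform_hess_comp//; exact: monomial_block.
rewrite (sh2 i).2 qform_sum; apply: eq_bigr => j _.
by rewrite qform_hess_comp//; exact: monomial_edge.
Qed.

End ChainPotential.

(** * Euclidean geometry and the operator norm *)

Section Euclidean.
Variable R : realType.

Definition dot n (u v : 'cV[R]_n) : R := \sum_i u i 0 * v i 0.

(** The square of [enorm], which keeps the estimates free of square roots. *)
Definition sqnorm n (u : 'cV[R]_n) : R := \sum_i u i 0 ^+ 2.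

Lemma dotE n (u v : 'cV[R]_n) : (u^T *m v) 0 0 = dot u v.
Proof. by rewrite mxE; apply: eq_bigr => i _; rewrite mxE. Qed.

Lemma sqnorm_ge0 n (u : 'cV[R]_n) : 0 <= sqnorm u.
Proof. by apply: sumr_ge0 => i _; exact: sqr_ge0. Qed.

Lemma sqnorm_eq0 n (u : 'cV[R]_n) : (sqnorm u == 0) = (u == 0).
Proof.
apply/eqP/eqP => [u0|->]; last by apply: big1 => i _; rewrite mxE expr0n.
apply/colP => i; rewrite mxE; apply/eqP; rewrite -sqrf_eq0; apply/eqP.
by move: (psumr_eq0P (fun j _ => sqr_ge0 (u j 0)) u0) => /(_ i isT).
Qed.

Lemma sqnorm_gt0 n (u : 'cV[R]_n) : u != 0 -> 0 < sqnorm u.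
Proof. by rewrite lt_def sqnorm_eq0 sqnorm_ge0 andbT. Qed.

Lemma sqnormZ n c (u : 'cV[R]_n) : sqnorm (c *: u) = c ^+ 2 * sqnorm u.
Proof. by rewrite mulr_sumr; apply: eq_bigr => i _; rewrite mxE exprMn. Qed.

Lemma dot_self n (u : 'cV[R]_n) : dot u u = sqnorm u.
Proof. by apply: eq_bigr => i _; rewrite expr2. Qed.

Lemma sqnormD n (u v : 'cV[R]_n) :
  sqnorm (u + v) = sqnorm u + 2 * dot u v + sqnorm v.
Proof.
rewrite mulr_sumr -!big_split; apply: eq_bigr => i _ /=.
by rewrite mxE sqrrD mulr_natl.
Qed.

Lemma dotZr n c (u v : 'cV[R]_n) : dot u (c *: v) = c * dot u v.
Proof. by rewrite mulr_sumr; apply: eq_bigr => i _; rewrite mxE mulrCA. Qed.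

Lemma dotC n (u v : 'cV[R]_n) : dot u v = dot v u.
Proof. by apply: eq_bigr => i _; rewrite mulrC. Qed.

(** By the parallelogram identity the gap is [sqnorm (u + v)]. *)
Lemma sqnormB_le n (u v : 'cV[R]_n) :
  sqnorm (u - v) <= 2 * sqnorm u + 2 * sqnorm v.
Proof.
have := sqnorm_ge0 (u + v); rewrite -scaleN1r !sqnormD dotZr sqnormZ.
by lra.
Qed.

Lemma qform_scalar n c (u : 'cV[R]_n) : qform c%:M u = c * sqnorm u.
Proof.
by rewrite /qform mul_scalar_mx -scalemxAr mxE dotE dot_self.
Qed.

Lemma dot_CauchySchwarz n (u v : 'cV[R]_n) : dot u v ^+ 2 <= sqnorm u * sqnorm v.
Proof.
have [->|v0] := eqVneq v 0.
  rewrite /dot big1 ?expr0n ?mulr_ge0 ?sqnorm_ge0// => i _.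
  by rewrite mxE mulr0.
(* This vector is [sqnorm v] times the component of [u] orthogonal to [v]; its squared norm is
   [sqnorm v] times the gap in the inequality. *)
have := sqnorm_ge0 (sqnorm v *: u + (- dot u v) *: v).
rewrite sqnormD dotZr (dotC (_ *: u)) dotZr (dotC v) !sqnormZ.
set D := dot u v; set S := sqnorm u; have := sqnorm_gt0 v0; set T := sqnorm v.
move=> T0; have -> : T ^+ 2 * S + 2 * (- D * (T * D)) + (- D) ^+ 2 * T =
  T * (S * T - D ^+ 2) by ring.
by rewrite pmulr_rge0// subr_ge0.
Qed.

Lemma enormE n (u : 'cV[R]_n) : enorm u = Num.sqrt (sqnorm u).
Proof. by []. Qed.

(** The Frobenius norm is a bound, by Cauchy-Schwarz on each row. Boundedness is what makes the
    [sup] in [opnorm] an upper bound of the set. *)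
Lemma opnorm_has_ubound n (A : 'M[R]_n) :
  has_ubound [set enorm (A *m u) | u in [set u | enorm u <= 1]].
Proof.
exists (Num.sqrt (\sum_i sqnorm (row i A)^T)) => _ [u /= u1 <-].
have {}u1 : sqnorm u <= 1 by rewrite -(ler_sqrt (sqnorm u))// sqrtr1.
rewrite enormE ler_wsqrtr//; apply: ler_sum => i _.
have -> : (A *m u) i 0 = dot (row i A)^T u.
  by rewrite mxE; apply: eq_bigr => j _; rewrite !mxE.
apply: (le_trans (dot_CauchySchwarz _ _)).
by rewrite ler_piMr ?sqnorm_ge0.
Qed.

Lemma opnorm_ge0 n (A : 'M[R]_n) : 0 <= opnorm A.
Proof.
apply: le_trans (ub_le_sup (opnorm_has_ubound A) _); last first.
  exists 0 => //=; rewrite enormE (_ : sqnorm _ = 0) ?sqrtr0//.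
  by apply/eqP; rewrite sqnorm_eq0.
exact: sqrtr_ge0.
Qed.

(** A nonzero [u] is normalised to [c *: u], where Cauchy-Schwarz bounds the form by
    [enorm (A *m (c *: u))]; homogeneity of degree two returns to [u]. *)
Lemma qform_le_opnorm n (A : 'M[R]_n) u : qform A u <= opnorm A * sqnorm u.
Proof.
have [->|u0] := eqVneq u 0.
  by rewrite /qform mulmx0 mulmx0 mxE mulr_ge0 ?opnorm_ge0 ?sqnorm_ge0.
have s0 := sqnorm_gt0 u0; pose c := (Num.sqrt (sqnorm u))^-1.
have c2 : c ^+ 2 * sqnorm u = 1.
  by rewrite /c exprVn sqr_sqrtr ?ltW// mulVf ?gt_eqF.
have cu1 : enorm (c *: u) = 1 by rewrite enormE sqnormZ c2 sqrtr1.
have opA : enorm (A *m (c *: u)) <= opnorm A.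
  by apply: (ub_le_sup (opnorm_has_ubound A)); exists (c *: u) => //=; rewrite cu1.
have qA : qform A (c *: u) <= enorm (A *m (c *: u)).
  rewrite /qform dotE enormE; apply: (le_trans (ler_norm _)).
  rewrite -sqrtr_sqr ler_wsqrtr// (le_trans (dot_CauchySchwarz _ _))//.
  by rewrite sqnormZ c2 mul1r.
have -> : qform A u = qform A (c *: u) * sqnorm u.
  have ZT : (c *: u)^T = c *: u^T by rewrite linearZ.
  rewrite /qform ZT -!scalemxAr -scalemxAl scalerA -expr2 [in RHS]mxE.
  by rewrite mulrAC c2 mul1r.
by rewrite ler_pM2r// (le_trans qA).
Qed.

Lemma hess_norm_ge0 n (f : 'rV[R]_n -> R) : bounded_hess f -> 0 <= hess_norm f.
Proof.
move=> bf; apply: le_trans (ub_le_sup bf _); last by exists 0.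
exact: opnorm_ge0.
Qed.

Lemma qform_hess_le n (f : 'rV[R]_n -> R) x u : bounded_hess f ->
  qform (hess f x) u <= hess_norm f * sqnorm u.
Proof.
move=> bf; apply: (le_trans (qform_le_opnorm _ _)).
rewrite ler_wpM2r ?sqnorm_ge0//; apply: (ub_le_sup bf); by exists x.
Qed.

End Euclidean.

(** * Block decomposition of the norm and counting of edges *)

Section Blocks.
Variables (R : realType) (p N : nat).

Lemma sqnorm_block (u : 'cV[R]_(N * p)) :
  sqnorm u = \sum_i sqnorm (block u^T i)^T.
Proof.
rewrite /sqnorm pair_bigA /=.
rewrite (reindex (uncurry (@mxvec_index N p))) /=; last exact: curry_mxvec_bij.
by apply: eq_bigr => -[i k] _ /=; rewrite !mxE.
Qed.

(** Meant for the successors or the predecessors of a vertex: there is at most one, and none at an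
    end of the chain, hence an inequality. *)
Lemma sum_subsingleton_le (P : pred 'I_N) (c : R) : 0 <= c ->
  (forall i j, P i -> P j -> i = j) -> \sum_(i | P i) c <= c.
Proof.
move=> c0 uP; case: (pickP P) => [i Pi|P0]; last by rewrite big_pred0.
by rewrite (big_pred1 i)// => j; apply/idP/eqP => [Pj|->//]; exact: uP.
Qed.

Lemma sum_edges_le (a : 'I_N -> R) : (forall i, 0 <= a i) ->
  \sum_(i < N) \sum_(j < N | j == i.+1 :> nat) (2 * a i + 2 * a j) <= 4 * \sum_i a i.
Proof.
move=> a0; have -> : 4 * \sum_i a i = \sum_i 2 * a i + \sum_i 2 * a i.
  by rewrite -mulr_sumr; ring.
under eq_bigr do rewrite big_split.
rewrite big_split; apply: lerD.
  apply: ler_sum => i _; apply: sum_subsingleton_le; first by rewrite mulr_ge0.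
  by move=> j k /eqP jE /eqP kE; apply/val_inj; rewrite /= jE kE.
(* After the exchange the inner sum runs over the predecessors of [j]. *)
rewrite (exchange_big_dep xpredT)//=; apply: ler_sum => j _.
apply: sum_subsingleton_le; first by rewrite mulr_ge0.
by move=> i k /eqP -> /eqP[/val_inj].
Qed.

End Blocks.

(** * The Jacobian of the drift *)

Lemma is_derive_coord (R : realType) n (k : 'I_n) (x v : 'rV[R]_n) :
  is_derive x v (fun w : 'rV[R]_n => w 0 k) (v 0 k).
Proof.
have did : derivable (id : 'rV[R]_n -> 'rV[R]_n) x v by exact: derivable_id.
have dk := (derivable_mxP (id : 'rV[R]_n -> 'rV[R]_n) x v).1 did 0 k.
split; first exact: dk.
by have := derive_mx did; rewrite derive_id => /matrixP/(_ 0 k); rewrite mxE.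
Qed.

(** Every component of the drift is built from coordinates and a partial derivative of [U] composed
    with the linear map [lsubmx], so directional derivatives suffice. *)
Lemma Jac_langevin (R : realType) n (U : 'rV[R]_n -> R) (gamma : R) z : smooth U ->
  Jac (fun w : 'rV[R]_(n + n) => row_mx (rsubmx w)
         (- grad U (lsubmx w) - gamma *: rsubmx w)) z =
  block_mx 0 1%:M (- hess U (lsubmx z)) (- gamma%:M).
Proof.
move=> sU; apply/matrixP => i j; rewrite mxE.
case: (split_ordP i) => a ->.
  have -> : (fun w : 'rV[R]_(n + n) => row_mx (rsubmx w)
      (- grad U (lsubmx w) - gamma *: rsubmx w) 0 (lshift n a)) =
      (fun w => w 0 (rshift n a)).
    by apply/funext => w; rewrite row_mxEl mxE.
  have dk := is_derive_coord (rshift n a) z (delta_mx 0 j).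
  rewrite /partial derive_val; case: (split_ordP j) => b ->.
    by rewrite block_mxEul !mxE eq_rlshift.
  by rewrite block_mxEur !mxE eqxx (inj_eq (@rshift_inj _ _)).
have -> : (fun w : 'rV[R]_(n + n) => row_mx (rsubmx w)
    (- grad U (lsubmx w) - gamma *: rsubmx w) 0 (rshift n a)) =
    - (partial a U \o lsubmx) - gamma *: (fun w => w 0 (rshift n a)).
  by apply/funext => w; rewrite row_mxEr !mxE.
have dk := is_derive_coord (rshift n a) z (delta_mx 0 j).
case: (split_ordP j) dk => b -> dk.
  have dU : is_derive z (delta_mx 0 (lshift n b)) (partial a U \o lsubmx)
      (partial b (partial a U) (lsubmx z)).
    apply: is_derive_comp_linear.
    rewrite [X in is_derive _ X _ _](_ : _ = delta_mx 0 b); last first.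
      by apply/rowP => k; rewrite !mxE (inj_eq (@lshift_inj _ _)).
    exact: (is_derive_iter_partial [:: a]).
  rewrite /partial derive_val block_mxEdl !mxE eq_rlshift andbF scaler0 subr0.
  (* [Jac] differentiates along its column index last, [hess] along its row index last; Schwarz's
     theorem reconciles the two. *)
  by rewrite -[LHS]/(- partial b (partial a U) (lsubmx z)) partialC.
(* A velocity direction is sent to 0 by [lsubmx]. *)
have dU : is_derive z (delta_mx 0 (rshift n b)) (partial a U \o lsubmx) 0.
  apply: is_derive_comp_linear.
  rewrite [X in is_derive _ X _ _](_ : _ = 0); last first.
    by apply/rowP => k; rewrite !mxE eq_lrshift andbF.
  exact: is_derive0.
rewrite /partial derive_val block_mxEdr !mxE (inj_eq (@rshift_inj _ _)) eqxx.
by rewrite oppr0 sub0r; congr (- _); exact: mulr_natr.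
Qed.

(** * The twisted metric and its contraction estimate *)

Section Contraction.
Variables (R : realType) (n : nat).

Definition bform (A : 'M[R]_n) (a b : 'cV[R]_n) : R := (a^T *m (A *m b)) 0 0.

Lemma bformD A B a b : bform (A + B) a b = bform A a b + bform B a b.
Proof. by rewrite /bform mulmxDl mulmxDr mxE. Qed.

Lemma bformZ c A a b : bform (c *: A) a b = c * bform A a b.
Proof. by rewrite /bform -scalemxAl -scalemxAr mxE. Qed.

Lemma bformN A a b : bform (- A) a b = - bform A a b.
Proof. by rewrite /bform mulNmx mulmxN mxE. Qed.

Lemma bform_scalar c a b : bform c%:M a b = c * dot a b.
Proof. by rewrite /bform mul_scalar_mx -scalemxAr mxE dotE. Qed.

Lemma bformDl A a b c : bform A (a + b) c = bform A a c + bform A b c.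
Proof. by rewrite /bform linearD mulmxDl mxE. Qed.

Lemma bformDr A a b c : bform A c (a + b) = bform A c a + bform A c b.
Proof. by rewrite /bform !mulmxDr mxE. Qed.

Lemma bformZl A t a c : bform A (t *: a) c = t * bform A a c.
Proof.
have aT : (t *: a)^T = t *: a^T by rewrite linearZ.
by rewrite /bform aT -scalemxAl mxE.
Qed.

Lemma bformZr A t a c : bform A c (t *: a) = t * bform A c a.
Proof. by rewrite /bform -!scalemxAr mxE. Qed.

Lemma bform_sym A a b : A^T = A -> bform A a b = bform A b a.
Proof.
move=> sA; rewrite /bform -[in LHS](trmxK (_ *m _)) [LHS]mxE.
by rewrite !trmx_mul trmxK sA mulmxA.
Qed.

Lemma qform_block (A B C D : 'M[R]_n) (a b : 'cV[R]_n) :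
  qform (block_mx A B C D) (col_mx a b) =
  bform A a a + bform B a b + bform C b a + bform D b b.
Proof.
have addE (X Y : 'M[R]_1) : (X + Y) 0 0 = X 0 0 + Y 0 0 by rewrite mxE.
by rewrite /qform mul_block_col tr_col_mx mul_row_col !mulmxDr !addE addrA.
Qed.

Lemma sqnorm_col (a b : 'cV[R]_n) : sqnorm (col_mx a b) = sqnorm a + sqnorm b.
Proof.
rewrite /sqnorm big_split_ord; congr (_ + _); apply: eq_bigr => i _.
  by rewrite col_mxEu.
by rewrite col_mxEd.
Qed.

(* With off-diagonal gamma^-1 the coefficient of dot a b in the form of M J
   vanishes. *)
Definition twist_mx (Lambda gamma : R) : 'M[R]_(n + n) :=
  block_mx 1%:M gamma^-1%:M gamma^-1%:M Lambda^-1%:M.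

Variables (Lambda gamma : R).
Hypotheses (Lambda_gt0 : 0 < Lambda) (gamma_ge : 2 * Num.sqrt Lambda <= gamma).

Let gamma_gt0 : 0 < gamma.
Proof. by apply: lt_le_trans gamma_ge; rewrite mulr_gt0// sqrtr_gt0. Qed.

Let gamma2 : 4 * Lambda <= gamma ^+ 2.
Proof.
rewrite -{1}(sqr_sqrtr (ltW Lambda_gt0)) (_ : 4 = 2 ^+ 2); last by ring.
by rewrite -exprMn lerXn2r// nnegrE ?ltW// mulr_gt0// sqrtr_gt0.
Qed.

Lemma qform_twist a b : qform (twist_mx Lambda gamma) (col_mx a b) =
  sqnorm a + 2 * gamma^-1 * dot a b + Lambda^-1 * sqnorm b.
Proof.
by rewrite /twist_mx qform_block !bform_scalar (dotC b a) !dot_self; ring.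
Qed.

(** Both signs follow from nonnegativity of the squared norms of [a + (2 / gamma) b] and
    [a - (2 / gamma) b], since [4 / gamma ^+ 2 <= Lambda^-1]. *)
Lemma twist_cross (a b : 'cV[R]_n) :
  `|2 * gamma^-1 * dot a b| <= 2^-1 * (sqnorm a + Lambda^-1 * sqnorm b).
Proof.
have g2 : gamma^-1 ^+ 2 <= 4^-1 * Lambda^-1.
  by rewrite exprVn -invfM lef_pV2// posrE ?mulr_gt0// exprn_gt0.
have b0 := sqnorm_ge0 b; have gb := ler_wpM2r b0 g2.
have h1 := sqnorm_ge0 (a + (2 * gamma^-1) *: b).
have h2 := sqnorm_ge0 (a + (- (2 * gamma^-1)) *: b).
move: h1 h2; rewrite !sqnormD !dotZr !sqnormZ sqrrN exprMn => h1 h2.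
by rewrite ler_norml; apply/andP; split; lra.
Qed.

Lemma le_qform_twist a b : 2^-1 * (sqnorm a + Lambda^-1 * sqnorm b) <=
  qform (twist_mx Lambda gamma) (col_mx a b).
Proof.
by rewrite qform_twist; have := twist_cross a b; rewrite ler_norml => /andP[]; lra.
Qed.

Lemma qform_twist_le a b : qform (twist_mx Lambda gamma) (col_mx a b) <=
  3 / 2 * (sqnorm a + Lambda^-1 * sqnorm b).
Proof.
by rewrite qform_twist; have := twist_cross a b; rewrite ler_norml => /andP[]; lra.
Qed.

Lemma tr_twist : (twist_mx Lambda gamma)^T = twist_mx Lambda gamma.
Proof. by rewrite tr_block_mx !tr_scalar_mx. Qed.

Lemma twist_ge : mxle (2^-1 * Num.min 1 Lambda^-1)%:M (twist_mx Lambda gamma).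
Proof.
move=> u; rewrite -(vsubmxK u) qform_scalar sqnorm_col.
apply: le_trans (le_qform_twist _ _); rewrite -mulrA ler_wpM2l ?invr_ge0//.
by rewrite mulrDr lerD// ?ler_piMl ?ler_wpM2r ?sqnorm_ge0// ge_min lexx ?orbT.
Qed.

Lemma twist_le : mxle (twist_mx Lambda gamma) (3 / 2 * Num.max 1 Lambda^-1)%:M.
Proof.
move=> u; rewrite -(vsubmxK u) qform_scalar sqnorm_col.
apply: (le_trans (qform_twist_le _ _)); rewrite -[leRHS]mulrA ler_wpM2l ?divr_ge0//.
by rewrite mulrDr lerD// ?ler_peMl ?ler_wpM2r ?sqnorm_ge0// le_max lexx ?orbT.
Qed.

Lemma posdef_twist : posdefmx (twist_mx Lambda gamma).
Proof.
move=> u u0; apply: lt_le_trans (twist_ge u); rewrite qform_scalar.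
by rewrite !mulr_gt0 ?sqnorm_gt0// lt_min ltr01 invr_gt0.
Qed.

(** Half of the term [qform A a / gamma] absorbs the cross term; the other half is at least
    [lambda / (2 * gamma) * sqnorm a]. The velocity term left over gives the same rate on
    [sqnorm b / Lambda]. *)
Lemma twist_contraction (A : 'M[R]_n) (lambda : R) : 0 < lambda ->
    lambda <= Lambda -> A^T = A -> mxle lambda%:M A -> mxle A Lambda%:M ->
  mxle (twist_mx Lambda gamma *m block_mx 0 1%:M (- A) (- gamma%:M))
       (- (lambda / (3 * gamma)) *: twist_mx Lambda gamma).
Proof.
move=> l0 lL sA lA AL u; rewrite -(vsubmxK u).
set a := usubmx u; set b := dsubmx u.
have -> : qform (- (lambda / (3 * gamma)) *: twist_mx Lambda gamma) (col_mx a b) =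
    - (lambda / (3 * gamma)) * qform (twist_mx Lambda gamma) (col_mx a b).
  by rewrite /qform -scalemxAl -scalemxAr mxE.
have -> : qform (twist_mx Lambda gamma *m block_mx 0 1%:M (- A) (- gamma%:M))
    (col_mx a b) = - (gamma^-1 * qform A a) - Lambda^-1 * bform A b a
      + (gamma^-1 - gamma * Lambda^-1) * sqnorm b.
  rewrite /twist_mx mulmx_block qform_block !mulmx0 !mulmx1 !add0r.
  rewrite !mulmxN !mul_scalar_mx !bformD !bformN !bformZ !bform_scalar !dot_self.
  have g0 : gamma^-1 * gamma = 1 by rewrite mulVf// gt_eqF.
  rewrite (mulrA gamma^-1 gamma) g0 -[bform A a a]/(qform A a) !mul1r.
  by move: (dot a b) (qform A a) (bform A b a) (sqnorm b) => d qa qab b2; ring.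
have a0 := sqnorm_ge0 a; have b0 := sqnorm_ge0 b.
have := lA a; rewrite qform_scalar => lAa.
have := AL b; rewrite qform_scalar => ALb.
have := lA (a + (gamma * Lambda^-1) *: b); rewrite qform_scalar => /(le_trans _).
move=> /(_ 0 (mulr_ge0 (ltW l0) (sqnorm_ge0 _))).
rewrite -[qform _ _]/(bform A _ _) !bformDl !bformDr !bformZl !bformZr.
rewrite (bform_sym a b sA) -[bform A a a]/(qform A a) -[bform A b b]/(qform A b).
have := qform_twist_le a b.
move: a0 b0 lAa ALb; set M := qform (twist_mx _ _) _.
move: (sqnorm a) (sqnorm b) (qform A a) (qform A b) (bform A b a) M.
move=> a2 b2 qa qb qab M a0 b0 lAa ALb Mle psd.
have ig0 : 0 < gamma^-1 by rewrite invr_gt0.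
have iL0 : 0 < Lambda^-1 by rewrite invr_gt0.
have gV : gamma^-1 * gamma = 1 by rewrite mulVf// gt_eqF.
have LV : Lambda^-1 * Lambda = 1 by rewrite mulVf// gt_eqF.
(* Nonnegativity of A at a + (gamma / Lambda) b. *)
have cross : - (Lambda^-1 * qab) <=
    2^-1 * gamma^-1 * qa + 2^-1 * (gamma * Lambda^-1) * b2.
  have h1 : 0 <= 2^-1 * gamma^-1 * qa + Lambda^-1 * qab
      + 2^-1 * (gamma * Lambda^-1) * (Lambda^-1 * qb).
    have := mulr_ge0 (ltW ig0) psd.
    have -> : gamma^-1 * (qa + gamma / Lambda * qab +
        (gamma / Lambda * qab + gamma / Lambda * (gamma / Lambda * qb))) =
      gamma^-1 * qa + 2 * (gamma^-1 * gamma) * (Lambda^-1 * qab) +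
      (gamma^-1 * gamma) * (gamma * Lambda^-1) * (Lambda^-1 * qb) by ring.
    rewrite gV; lra.
  have h2 : Lambda^-1 * qb <= b2.
    by have := ler_wpM2l (ltW iL0) ALb; rewrite mulrA LV mul1r.
  have := ler_wpM2l (ltW (mulr_gt0 gamma_gt0 iL0)) h2; lra.
(* Multiplied by [2 * gamma * Lambda], this says [2 * Lambda + lambda <= gamma ^+ 2], which holds as
   [lambda <= Lambda] and [4 * Lambda <= gamma ^+ 2]. *)
have vel : gamma^-1 - 2^-1 * (gamma * Lambda^-1) <=
    - (2^-1 * lambda * gamma^-1 * Lambda^-1).
  have : 0 <= gamma^-1 * Lambda^-1 * (gamma ^+ 2 - 2 * Lambda - lambda).
    apply: mulr_ge0; first by rewrite ltW ?mulr_gt0.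
    by have := gamma2; lra.
  have -> : gamma^-1 * Lambda^-1 * (gamma ^+ 2 - 2 * Lambda - lambda) =
    (gamma^-1 * gamma) * (gamma * Lambda^-1) - 2 * gamma^-1 * (Lambda^-1 * Lambda)
      - lambda * gamma^-1 * Lambda^-1 by ring.
  by rewrite gV LV; lra.
(* The factor 3/2 in the upper bound on the twisted form turns the rate [lambda / (3 * gamma)] into
   the available [lambda / (2 * gamma)]. *)
have rhoM : lambda / (3 * gamma) * M <=
    2^-1 * lambda * gamma^-1 * (a2 + Lambda^-1 * b2).
  have -> : lambda / (3 * gamma) = 3^-1 * (lambda * gamma^-1).
    by rewrite invfM; ring.
  have := ler_wpM2l (ltW (mulr_gt0 l0 ig0)) Mle; lra.
have velb := ler_wpM2r b0 vel.
have posa := ler_wpM2l (ltW ig0) lAa.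
rewrite mulNr; lra.
Qed.

End Contraction.

(** * Two-sided bounds on the Hessian of the chain, uniform in its length *)

Section HessianBounds.
Variables (R : realType) (p N : nat) (V F : 'rV[R]_p -> R).
Hypotheses (smoothV : smooth V) (smoothF : smooth F).

Lemma smooth_chain : smooth (@chain_potential R p N V F).
Proof. exact: (smooth_qform_chain 0 0 smoothV smoothF).1. Qed.

Lemma sum_edges_sqnorm_le (u : 'cV[R]_(N * p)) :
  \sum_(i < N) \sum_(j < N | j == i.+1 :> nat)
    sqnorm (block u^T i - block u^T j)^T <= 4 * sqnorm u.
Proof.
rewrite sqnorm_block; apply: le_trans (sum_edges_le _) => [|i]; last first.
  exact: sqnorm_ge0.
apply: ler_sum => i _; apply: ler_sum => j _.
by rewrite linearB sqnormB_le.
Qed.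

(** The edges cost at most [kappa * (4 * sqnorm u)], exactly the surplus [4 * kappa] in the
    convexity of [V]. *)
Lemma hess_chain_ge (kappa lambda : R) x : 0 <= kappa ->
    (forall y, mxle (- kappa)%:M (hess F y)) ->
    (forall y, mxle (lambda + 4 * kappa)%:M (hess V y)) ->
  mxle lambda%:M (hess (@chain_potential R p N V F) x).
Proof.
move=> k0 hF hV u; rewrite (smooth_qform_chain _ _ smoothV smoothF).2 qform_scalar.
have -> : lambda * sqnorm u = (lambda + 4 * kappa) * sqnorm u
    + - kappa * (4 * sqnorm u) by ring.
apply: lerD.
  rewrite sqnorm_block mulr_sumr; apply: ler_sum => i _.
  by rewrite -qform_scalar; exact: hV.
rewrite mulNr lerNl; apply: le_trans (ler_wpM2l k0 (sum_edges_sqnorm_le u)).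
rewrite -sumrN mulr_sumr; apply: ler_sum => i _.
rewrite -sumrN mulr_sumr; apply: ler_sum => j _.
by rewrite lerNl -mulNr -qform_scalar; exact: hF.
Qed.

Lemma hess_chain_le x : bounded_hess V -> bounded_hess F ->
  mxle (hess (@chain_potential R p N V F) x) (hess_norm V + 4 * hess_norm F)%:M.
Proof.
move=> bV bF u; rewrite (smooth_qform_chain _ _ smoothV smoothF).2 qform_scalar.
rewrite mulrDl (mulrC 4) -mulrA; apply: lerD.
  by rewrite sqnorm_block mulr_sumr; apply: ler_sum => i _; exact: qform_hess_le.
apply: le_trans (ler_wpM2l (hess_norm_ge0 bF) (sum_edges_sqnorm_le u)).
rewrite mulr_sumr; apply: ler_sum => i _.
by rewrite mulr_sumr; apply: ler_sum => j _; exact: qform_hess_le.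
Qed.

End HessianBounds.

Theorem proposition6 (R : realType) (p : nat) (hp : (1 <= p)%N)
    (V F : 'rV[R]_p -> R) (kappa lambda : R)
    (smoothV : smooth V) (smoothF : smooth F)
    (bddV : bounded_hess V) (bddF : bounded_hess F)
    (evenF : forall x, F (- x) = F x)
    (kappa_ge0 : 0 <= kappa)
    (hessF : forall x, mxle (- kappa)%:M (hess F x))
    (lambda_gt0 : 0 < lambda)
    (hessV : forall x, mxle (lambda + 4 * kappa)%:M (hess V x)) :
  let Lambda := hess_norm V + 4 * hess_norm F in
  (forall N : nat, (1 <= N)%N ->
     smooth (@chain_potential R p N V F) /\
     forall x : 'rV[R]_(N * p),
       mxle lambda%:M (hess (chain_potential V F) x) /\
       mxle (hess (chain_potential V F) x) Lambda%:M) /\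
  (forall gamma : R, 2 * Num.sqrt Lambda <= gamma ->
     forall N : nat, (1 <= N)%N ->
     forall T : 'I_N -> R, (forall i, 0 <= T i) ->
     exists M : 'M[R]_(N * p + N * p),
       [/\ M^T = M, posdefmx M,
           mxle (2^-1 * Num.min 1 Lambda^-1)%:M M,
           mxle M (3 / 2 * Num.max 1 Lambda^-1)%:M &
           Cont_R (drift (chain_sde V F gamma T)) M (lambda / (3 * gamma))]).
Proof.
move=> Lambda.
have bounds N x := conj
  (@hess_chain_ge R p N V F smoothV smoothF kappa lambda x kappa_ge0 hessF hessV)
  (@hess_chain_le R p N V F smoothV smoothF x bddV bddF).
split=> [N _|gamma gamma_ge N hN T _].
  by split; [exact: smooth_chain | exact: bounds].
(* The two Hessian bounds are compared at a nonzero vector, which exists because [N] and [p] are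
   positive. Positivity of [Lambda] follows. *)
have lambda_le : lambda <= Lambda.
  pose u : 'cV[R]_(N * p) := const_mx 1.
  have u0 : u != 0.
    apply/eqP => /colP /(_ (mxvec_index (Ordinal hN) (Ordinal hp))) /eqP.
    by rewrite !mxE oner_eq0.
  have [lo up] := bounds N 0; have := le_trans (lo u) (up u).
  by rewrite !qform_scalar ler_pM2r// sqnorm_gt0.
have Lambda_gt0 : 0 < Lambda by exact: lt_le_trans lambda_le.
exists (twist_mx _ Lambda gamma); split.
- exact: tr_twist.
- exact: posdef_twist.
- exact: twist_ge.
- exact: twist_le.
(* The drift of [chain_sde] is convertible to the map in [Jac_langevin] with the chain potential as
   [U]. *)
move=> z; rewrite [Jac _ _]Jac_langevin; last exact: smooth_chain.
have [lo up] := bounds N (lsubmx z).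
apply: twist_contraction => //; exact/tr_hess/smooth_chain.
Qed.
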